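(* There is an absolute constant $c>0$ such that for every sixth-power free $d \in \mathbb{Z}$, $$\zeta_d \ge c\,|d|^{1/36}.$$ Moreover, this bound is sharp: there is an absolute constant $C>0$ such that $\zeta_d \le C\,|d|^{1/36}$ for infinitely many sixth-power free $d \in \mathbb{Z}$.
   Context: An integer $d$ is sixth-power free if $d \neq 0$ and no sixth power of a prime divides $d$. For sixth-power free $d \in \mathbb{Z}$, $E_d$ denotes the elliptic curve over $\mathbb{Q}$ given by $y^2z = x^3 + dz^3$. For an elliptic curve $E/\mathbb{Q}$, $\hat{h}_E$ is the canonical height in Silverman's normalization: $\hat{h}_E(P) = \frac12 \lim_{n\to\infty} 4^{-n} h(x([2^n]P))$, where $h$ is the logarithmic absolute height on $\mathbb{P}^1(\overline{\mathbb{Q}})$ and $x$ is a Weierstrass $x$-coordinate (so $h([a:b]) = \log\max(|a|,|b|)$ for coprime integers $a,b$). Define $\zeta_d$ by $\log \zeta_d = \min\{\hat{h}_{E_d}(P) : P \in E_d(\mathbb{Q}) \setminus E_d(\mathbb{Q})_{\mathrm{tors}}\}$, and $\zeta_d = \infty$ if $E_d(\mathbb{Q}) \setminus E_d(\mathbb{Q})_{\mathrm{tors}}$ is empty. *)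

(* Defs.v *)
From HB Require Import structures.
From mathcomp Require Import all_boot all_order all_algebra.
From mathcomp Require Import all_classical all_reals all_analysis.

Set Implicit Arguments.
Unset Strict Implicit.
Unset Printing Implicit Defensive.

Import Order.TTheory GRing.Theory Num.Theory.
Import numFieldNormedType.Exports.

Local Open Scope classical_set_scope.
Local Open Scope ring_scope.

Definition sixth_power_free (d : int) : Prop :=
  d != 0 /\ forall p : nat, prime p -> ~~ (p%:Z ^+ 6 %| d)%Z.

(* The only point of y^2 z = x^3 + d z^3 with z = 0 is O = [0 : 1 : 0]; every
   other rational point is [x : y : 1] for a unique pair (x, y). *)
Inductive ecpoint : Type :=
  | Origin : ecpoint
  | Affine of rat & rat.

Definition EQ (d : int) : set ecpoint :=
  [set P | match P with
           | Origin => True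
           | Affine x y => y ^+ 2 = x ^+ 3 + d%:~R
           end].

(* Chord-tangent addition with identity Origin. In the Weierstrass form
   y^2 = x^3 + d it does not involve d. It is only meaningful for two points of
   the same EQ d, where x1 = x2 forces y1 = y2 or y1 = - y2. *)
Definition ecadd (P Q : ecpoint) : ecpoint :=
  match P, Q with
  | Origin, _ => Q
  | _, Origin => P
  | Affine x1 y1, Affine x2 y2 =>
      if (x1 == x2) && (y1 == - y2) then Origin else
      let l := if x1 == x2 then 3 * x1 ^+ 2 / (2 * y1)
               else (y2 - y1) / (x2 - x1) in
      let x3 := l ^+ 2 - x1 - x2 in
      Affine x3 (l * (x1 - x3) - y1)
  end.

Definition ecmul (n : nat) (P : ecpoint) : ecpoint := iter n (ecadd P) Origin.

Definition EQ_tors (d : int) : set ecpoint :=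
  [set P | EQ d P /\ exists2 n : nat, (0 < n)%N & ecmul n P = Origin].

(* Coprime integral coordinates of the image of P under x : E -> P^1, which
   sends [x : y : 1] to [x : 1] and O to [1 : 0]. *)
Definition xcoord (P : ecpoint) : int * int :=
  match P with
  | Origin => (1, 0)
  | Affine x _ => (numq x, denq x)
  end.

Definition log_height (R : realType) (ab : int * int) : R :=
  ln (Num.max `|ab.1| `|ab.2|)%:~R.

(* Silverman's normalization. The sequence converges for P on any curve EQ d
   with d != 0. *)
Definition canonical_height (R : realType) (P : ecpoint) : R :=
  2^-1 * lim ((fun n : nat =>
    (4 ^+ n)^-1 * log_height R (xcoord (ecmul (2 ^ n) P))) @ \oo).

(* By Northcott's theorem the infimum over a nonempty set of non-torsion points
   is a minimum; over the empty set it is +oo, and expeR +oo = +oo. *)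
Definition log_zeta (R : realType) (d : int) : \bar R :=
  ereal_inf [set (canonical_height R P)%:E | P in EQ d `\` EQ_tors d].

Definition zeta (R : realType) (d : int) : \bar R := expeR (log_zeta R d).

(* Main.v *)
Require Import Defs.
From HB Require Import structures.
From mathcomp Require Import all_boot all_order all_algebra.
From mathcomp Require Import all_classical all_reals all_analysis.
From mathcomp Require Import ring lra zify.

(** The proof replaces the point [P = (x, y)] of [y^2 = x^3 + d] by the single
    rational number [t = x^3 / d], so that [t + 1 = y^2 / d].

    Over an algebraic closure [E_d] is isomorphic to [E_1], and [t] becomes the
    function [x^3] on [E_1], which has degree 6; hence the canonical height of
    [P] is [h(t) / 6 + O(1)] with a constant that does not involve [d]. This
    can be seen without leaving the rationals. Doubling acts on [t] through the
    map [t (t - 8)^3 / (64 (t + 1)^3)], of degree 4 and free of [d], so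
    [h(t(2P)) = 4 h(t(P)) + O(1)] uniformly; and [h(t)] differs from [3 h(x)]
    by at most [log |d|], which disappears after dividing by [4^n]
    ([canonical_height_ecparam]).

    Lower bound. Write [t = u / w] in lowest terms and [v = u + w]. Then
    [w u^2 v^3 = d r^6] with [r = w x y / d], a nonzero rational as soon as [P]
    is neither 2-torsion ([y = 0]) nor 3-torsion ([x = 0]). As [d] is
    sixth-power free, [r] is an integer, whence
    [|d| <= |w u^2 v^3| <= 8 H(t)^6] ([sixth_power_free_le_height]). So [h(t)]
    is at least [log |d| / 6 + O(1)] and the canonical height of [P] at least
    [log |d| / 36 + O(1)].

    Sharpness. The inequality is an equality up to a constant when [r = 1] and
    [u], [v], [w] have comparable size. Take [u = 4j + 1], [w = 4j + 2],
    [v = 8j + 3] and [d = w u^2 v^3], with [P = (uv, uv^2)]; this [d] is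
    sixth-power free when the three linear forms have squarefree values, and a
    sieve gives infinitely many such [j], because the sum of [1 / q^2] over the
    odd [q >= 3] is at most 1/4 ([odd_squarefree_values]). The point is not
    torsion since its height is large: the heights of the [2^k P] then increase
    strictly.

    The multiples in the canonical height are iterated sums
    [P + (P + (P + ...))], so one needs [(2n)P = nP + nP]. It is obtained from
    two special cases of associativity, [-P + (P + Q) = Q] and
    [2A + P = A + (A + P)] ([ecaddKl], [ecadd_dblA]). *)

Set Implicit Arguments.
Unset Strict Implicit.
Unset Printing Implicit Defensive.

Import Order.TTheory GRing.Theory Num.Theory.
Import numFieldNormedType.Exports.

Local Open Scope classical_set_scope.
Local Open Scope ring_scope.

(** * Chord-tangent addition: closure and commutativity *)

Definition ecneg (P : ecpoint) : ecpoint :=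
  if P is Affine x y then Affine x (- y) else Origin.

Lemma ecnegK : involutive ecneg.
Proof. by case=> [|x y] //=; rewrite opprK. Qed.

Lemma EQ_neg (d : int) P : EQ d P -> EQ d (ecneg P).
Proof. by case: P => [|x y] //=; rewrite /EQ/= sqrrN. Qed.

Lemma ecadd0r P : ecadd P Origin = P. Proof. by case: P. Qed.

Lemma ecadd_oppr P : ecadd P (ecneg P) = Origin.
Proof. by case: P => [|x y] //=; rewrite opprK !eqxx. Qed.

Lemma ecaddNl P : ecadd (ecneg P) P = Origin.
Proof. by rewrite -{2}(ecnegK P) ecadd_oppr. Qed.

Lemma ecadd_dbl x y : y != 0 -> let l := 3 * x ^+ 2 / (2 * y) in
  ecadd (Affine x y) (Affine x y) =
  Affine (l ^+ 2 - x - x) (l * (x - (l ^+ 2 - x - x)) - y).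
Proof.
move=> y0 /=; rewrite eqxx /=; case: eqP => // e.
by case/eqP: y0; lra.
Qed.

Lemma ecadd_chord x1 y1 x2 y2 : x1 != x2 -> let l := (y2 - y1) / (x2 - x1) in
  ecadd (Affine x1 y1) (Affine x2 y2) =
  Affine (l ^+ 2 - x1 - x2) (l * (x1 - (l ^+ 2 - x1 - x2)) - y1).
Proof. by move=> /negbTE x12 /=; rewrite x12. Qed.

Lemma EQ_samex (d : int) x y y' : EQ d (Affine x y) -> EQ d (Affine x y') ->
  y' = y \/ y' = - y.
Proof.
rewrite /EQ/= => <- /eqP; rewrite eqf_sqr => /orP[] /eqP; by [left|right].
Qed.

(** The branches of [ecadd] as they occur for two points of one curve: since
    equal abscissas force equal or opposite ordinates, a tangent is only drawn
    at a point with [y <> 0]. *)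
Variant ecadd_spec (d : int) : ecpoint -> ecpoint -> Type :=
 | EcaddOl P : ecadd_spec d Origin P
 | EcaddOr P : ecadd_spec d P Origin
 | EcaddN P : ecadd_spec d P (ecneg P)
 | EcaddD x y of y != 0 : ecadd_spec d (Affine x y) (Affine x y)
 | EcaddC x1 y1 x2 y2 of x1 != x2 :
     ecadd_spec d (Affine x1 y1) (Affine x2 y2).

Lemma ecaddP (d : int) P Q : EQ d P -> EQ d Q -> ecadd_spec d P Q.
Proof.
case: P => [|x1 y1]; first by move=> *; exact: EcaddOl.
case: Q => [|x2 y2]; first by move=> *; exact: EcaddOr.
have [<- e1 e2|x12 _ _] := eqVneq x1 x2; last exact: EcaddC.
have [y0|y0] := eqVneq y2 (- y1).
  by rewrite y0; exact: (EcaddN d (Affine x1 y1)).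
have -> : y2 = y1 by case: (EQ_samex e1 e2) => // /eqP; rewrite (negbTE y0).
apply: EcaddD; apply: contra y0 => /eqP y0; apply/eqP.
by case: (EQ_samex e1 e2); rewrite y0 oppr0.
Qed.

Lemma ecaddC (d : int) P Q : EQ d P -> EQ d Q -> ecadd P Q = ecadd Q P.
Proof.
move=> eP eQ; case: (ecaddP eP eQ) => // [R|R|R|x1 y1 x2 y2 x12].
- by rewrite ecadd0r.
- by rewrite ecadd0r.
- by rewrite ecadd_oppr ecaddNl.
rewrite ecadd_chord // ecadd_chord 1?eq_sym //.
have x21: x2 - x1 != 0 by rewrite subr_eq0 eq_sym.
have x12' : x1 - x2 != 0 by rewrite subr_eq0.
by congr Affine; field; rewrite x21 x12'.
Qed.

Lemma ecneg_add P Q : ecneg (ecadd P Q) = ecadd (ecneg P) (ecneg Q).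
Proof.
case: P Q => [|x1 y1] [|x2 y2] //=.
rewrite eqr_opp; case: ifP => //= /negbT.
rewrite negb_and => h.
have [e|e] := eqVneq x1 x2; congr Affine;
  try by field; rewrite subr_eq0 eq_sym.
- by rewrite mulrN invrN mulrN sqrrN.
- by rewrite mulrN invrN mulrN sqrrN; ring.
Qed.

(** Subtracting the two curve equations and dividing by [x2 - x1] turns the
    condition that both points lie on the curve into a relation in which [D]
    no longer appears. *)
Lemma chord_slope (F : fieldType) (x1 y1 x2 y2 D : F)
    (l := (y2 - y1) / (x2 - x1)) :
  x1 != x2 -> y1 ^+ 2 = x1 ^+ 3 + D -> y2 ^+ 2 = x2 ^+ 3 + D ->
  y2 = l * (x2 - x1) + y1 /\
  x1 ^+ 2 + x1 * x2 + x2 ^+ 2 = l * (2 * y1 + l * (x2 - x1)).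
Proof.
move=> x12 e1 e2.
have p0 : x2 - x1 != 0 by rewrite subr_eq0 eq_sym.
have el : y2 = l * (x2 - x1) + y1 by rewrite /l divfK // subrK.
split=> //; clearbody l.
apply: (mulfI p0); apply/eqP; rewrite -subr_eq0; apply/eqP.
transitivity ((y1 ^+ 2 - (x1 ^+ 3 + D)) - (y2 ^+ 2 - (x2 ^+ 3 + D))).
  by rewrite el; ring.
by rewrite e1 e2 !subrr.
Qed.

Lemma EQ_add (d : int) P Q : EQ d P -> EQ d Q -> EQ d (ecadd P Q).
Proof.
move=> eP eQ; have S := ecaddP eP eQ.
case: S eP eQ => [R|R|R|x y y0|x1 y1 x2 y2 x12] //.
- by rewrite ecadd0r.
- by rewrite ecadd_oppr.
- rewrite ecadd_dbl // /EQ/= => e _.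
  have -> : d%:~R = y ^+ 2 - x ^+ 3 by rewrite e addrAC subrr add0r.
  by field.
- rewrite ecadd_chord // /EQ/= => e1 e2.
  have [_] := chord_slope x12 e1 e2; set l := _ / _ => eh.
  have ed : d%:~R = y1 ^+ 2 - x1 ^+ 3 by rewrite e1 addrAC subrr add0r.
  apply/eqP; rewrite -subr_eq0 ed; apply/eqP.
  transitivity ((x1 ^+ 2 + x1 * x2 + x2 ^+ 2 - l * (2 * y1 + l * (x2 - x1)))
                * (2 * x1 + x2 - l ^+ 2)); first by ring.
  by rewrite eh subrr mul0r.
Qed.

(** * Two cases of associativity, and the doubling of multiples *)

(** The generic case of [2A + P = A + B] with [B = A + P]: the lines through
    [2A], [P] and through [A], [B] have slopes [s] and [r]. The identity
    [s = r + l - m], with [l] the slope of the line through [A], [P] and [m]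
    that of the tangent at [A], makes both coordinates easy to compare. *)
Lemma dbl_chord_slopes (F : realFieldType) (xa xp ya yp D : F) :
  let l := (yp - ya) / (xp - xa) in
  let m := 3 * xa ^+ 2 / (2 * ya) in
  let x2 := m ^+ 2 - xa - xa in
  let y2 := m * (xa - x2) - ya in
  let xb := l ^+ 2 - xa - xp in
  let yb := l * (xa - xb) - ya in
  let s := (yp - y2) / (xp - x2) in
  let r := (yb - ya) / (xb - xa) in
  ya ^+ 2 = xa ^+ 3 + D -> yp ^+ 2 = xp ^+ 3 + D ->
  xa != xp -> ya != 0 -> x2 != xp -> xb != xa ->
  s ^+ 2 - x2 - xp = r ^+ 2 - xa - xb /\
  s * (x2 - (s ^+ 2 - x2 - xp)) - y2 = r * (xa - (r ^+ 2 - xa - xb)) - ya.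
Proof.
move=> l m x2 y2 xb yb s r ea ep xap y0 x2p xba.
have b0 : xb - xa != 0 by rewrite subr_eq0.
have d0 : xp - x2 != 0 by rewrite subr_eq0 eq_sym.
have em : 3 * xa ^+ 2 = 2 * ya * m by rewrite /m; field.
have er : (r + l) * (xb - xa) = - 2 * ya.
  by rewrite mulrDl /r divfK // /yb; ring.
have [el eh] := chord_slope xap ea ep; rewrite -/l in el eh.
clearbody l m r.
have k : (xp - xa) * (xb - xa) = 2 * ya * (m - l) by rewrite /xb; lra.
have kr : (l - m) * (r + l) = xp - xa.
  by apply: (mulIf b0); rewrite -mulrA er k; ring.
have es : s = r + l - m.
  apply: (mulIf d0); rewrite /s divfK //; apply: (mulIf b0).
  transitivity ((l + m) * ((xp - xa) * (xb - xa)) +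
                (2 * ya - m * (xp - x2)) * (xb - xa)).
    by rewrite /y2 el; ring.
  transitivity (((r + l) * (xb - xa)) * (xp - x2) -
                m * (xp - x2) * (xb - xa)).
    by rewrite k er /x2 /xb; ring.
  by ring.
clearbody s.
have ex : s ^+ 2 - x2 - xp = r ^+ 2 - xa - xb.
  apply/eqP; rewrite -subr_eq0; apply/eqP.
  transitivity (2 * ((l - m) * (r + l) - (xp - xa))).
    by rewrite es /x2 /xb; ring.
  by rewrite kr subrr mulr0.
split => //; rewrite ex es.
apply/eqP; rewrite -subr_eq0; apply/eqP.
transitivity (((l - m) * (r + l) - (xp - xa)) * (- m - r) +
   ((r + l) * (xb - xa) - (- 2 * ya))); last first.
  by rewrite kr er !subrr mul0r addr0.
by rewrite /y2 /x2 /xb; ring.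
Qed.

(** If the line of slope [l] through [(x1, y1)] meets the curve again at
    abscissas [x2] and [x3], its mirror image through [-(x1, y1)] and
    [(x1, y1) + (x2, y2)] leads back to the point above [x2]. Both the chord
    ([x2 <> x1]) and the tangent ([x2 = x1]) case of [ecaddKl] use it. *)
Lemma ecadd_line x1 y1 x2 l (x3 := l ^+ 2 - x1 - x2) :
  x3 != x1 ->
  ecadd (Affine x1 (- y1)) (Affine x3 (l * (x1 - x3) - y1)) =
  Affine x2 (l * (x2 - x1) + y1).
Proof.
move=> x31; rewrite ecadd_chord 1?eq_sym //.
have x310 : x3 - x1 != 0 by rewrite subr_eq0.
have -> : (l * (x1 - x3) - y1 - - y1) / (x3 - x1) = - l by field.
by rewrite /x3; congr Affine; ring.
Qed.

Section Group.
Variable d : int.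
Hypothesis d0 : d != 0.

Lemma ecaddKl P Q : EQ d P -> EQ d Q -> ecadd (ecneg P) (ecadd P Q) = Q.
Proof.
have D0 : d%:~R != 0 :> rat by rewrite intr_eq0.
move=> eP eQ; have S := ecaddP eP eQ; case: S eP eQ.
- by [].
- by move=> R _ _; rewrite ecadd0r ecaddNl.
- by move=> R _ _; rewrite ecadd_oppr ecadd0r.
- move=> x y y0 e _; rewrite ecadd_dbl // /ecneg.
  set l := _ / _; have [x31|x31] := eqVneq (l ^+ 2 - x - x) x; last first.
    by rewrite ecadd_line //; congr Affine; ring.
  rewrite x31 subrr mulr0 sub0r ecadd_dbl ?oppr_eq0 //.
  have -> : 3 * x ^+ 2 / (2 * - y) = - l by rewrite /l; field.
  by rewrite sqrrN x31; congr Affine; ring.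
- move=> x1 y1 x2 y2 x12 e1 e2; have [ey eh] := chord_slope x12 e1 e2.
  rewrite ecadd_chord // /ecneg; set l := _ / _ in ey eh *.
  have [x31|x31] := eqVneq (l ^+ 2 - x1 - x2) x1; last first.
    by rewrite ecadd_line // ey.
  (* the chord is tangent at P, so P + Q = - P and -P + -P has to be Q *)
  rewrite x31 subrr mulr0 sub0r.
  have et : 3 * x1 ^+ 2 = 2 * y1 * l.
    have ex2 : x2 = l ^+ 2 - 2 * x1 by move: x31; lra.
    transitivity (l * (2 * y1 + l * (x2 - x1)) - l ^+ 2 * (x2 - x1)).
      by rewrite -eh ex2; ring.
    by ring.
  have y0 : y1 != 0.
    apply: contra D0 => /eqP y0; move: et e1; rewrite /EQ/= y0 mulr0 mul0r.
    move/eqP; rewrite mulf_eq0 pnatr_eq0 /= expf_eq0 /= => /eqP ->.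
    by rewrite expr0n /= add0r => <-.
  rewrite ecadd_dbl ?oppr_eq0 //.
  have -> : 3 * x1 ^+ 2 / (2 * - y1) = - l by rewrite et; field.
  rewrite sqrrN.
  have -> : l ^+ 2 - x1 - x1 = x2 by move: x31; lra.
  by rewrite [in RHS]ey; congr Affine; ring.
Qed.

Lemma ecaddNKl P Q : EQ d P -> EQ d Q -> ecadd P (ecadd (ecneg P) Q) = Q.
Proof. by move=> eP eQ; rewrite -{1}(ecnegK P) ecaddKl //; exact: EQ_neg. Qed.

Lemma ecadd_subl P Q S : EQ d P -> EQ d Q -> ecadd P Q = S ->
  Q = ecadd (ecneg P) S.
Proof. by move=> eP eQ <-; rewrite ecaddKl. Qed.

(** When [2A <> P] every degenerate position reduces to cancellation
    ([ecaddKl]), and [dbl_chord_slopes] settles the generic one. *)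
Lemma ecadd_dblA_neq A P : EQ d A -> EQ d P -> ecadd A A <> P ->
  ecadd (ecadd A A) P = ecadd A (ecadd A P).
Proof.
move=> eA eP; have eQ := EQ_add eA eA.
have S := ecaddP eA eP; case: S eA eP eQ.
- by [].
- by move=> R; rewrite !ecadd0r.
- move=> R eR eNR eQ _.
  by rewrite (ecaddC eQ eNR) ecaddKl // ecadd_oppr ecadd0r.
- by move=> x y y0 e _ eQ _; rewrite (ecaddC eQ e).
move=> xa ya xp yp xap eA eP eQ QP.
have [ya0|ya0] := eqVneq ya 0.
  have -> : ecadd (Affine xa ya) (Affine xa ya) = Origin.
    by rewrite /= ya0 oppr0 !eqxx.
  have eN : Affine xa ya = ecneg (Affine xa ya) by rewrite ya0 /= oppr0.
  by rewrite {1}eN ecaddKl.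
have EQ2 := ecadd_dbl xa ya0.
have dblN : ecadd (Affine xa ya) (ecadd (Affine xa ya)
    (ecneg (ecadd (Affine xa ya) (Affine xa ya)))) = Origin.
  by rewrite ecneg_add ecaddNKl ?ecadd_oppr //; exact: EQ_neg.
have [x2p|x2p] := eqVneq ((3 * xa ^+ 2 / (2 * ya)) ^+ 2 - xa - xa) xp.
  rewrite EQ2 x2p in eQ QP.
  case: (EQ_samex eQ eP) => yE; first by case: QP; rewrite yE.
  have PE : Affine xp yp = ecneg (ecadd (Affine xa ya) (Affine xa ya)).
    by rewrite EQ2 yE x2p.
  by rewrite PE dblN ecadd_oppr.
have EB := ecadd_chord ya yp xap.
(* A + P = A would give P = O, and A + P = - A would give P = - 2A *)
have xba : ((yp - ya) / (xp - xa)) ^+ 2 - xa - xp != xa.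
  apply/eqP => xba; have := EQ_add eA eP; rewrite EB xba => eB.
  have KP := ecaddKl eA eP; move: KP; rewrite EB xba.
  case: (EQ_samex eA eB) => ->; first by rewrite ecaddNl.
  rewrite -[Affine xa (- ya)]/(ecneg (Affine xa ya)) -ecneg_add EQ2 => -[/eqP].
  by rewrite (negbTE x2p).
have [ex ey] := dbl_chord_slopes eA eP xap ya0 x2p xba.
rewrite EB EQ2 ecadd_chord // ecadd_chord 1?eq_sym //.
by rewrite ey ex.
Qed.

(** In the remaining case [P = B = 2A] the claim is [2B = A + (A + B)]. It
    follows from [ecadd_dblA_neq] applied to [B] and [-A], that is
    [2B - A = B + (B - A) = B + A], unless [2B = -A]; and then [B = -(B + A)],
    so [A + (A + B) = A - B = -A] as well. *)
Lemma ecadd_dblA A P : EQ d A -> EQ d P ->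
  ecadd (ecadd A A) P = ecadd A (ecadd A P).
Proof.
move=> eA eP; have [PE|] := pselect (ecadd A A = P); last exact: ecadd_dblA_neq.
rewrite -PE; set B := ecadd A A.
have eB : EQ d B by exact: EQ_add.
have eNA := EQ_neg eA; have eNB := EQ_neg eB.
have BA : ecadd B (ecneg A) = A by rewrite (ecaddC eB eNA) /B ecaddKl.
have [BN|BN] := pselect (ecadd B B = ecneg A).
  have AB : ecadd A B = ecneg B.
    by rewrite {2}(ecadd_subl eB eB BN) -ecneg_add ecnegK (ecaddC eA eB).
  by rewrite BN AB /B ecneg_add ecaddNKl.
have := ecadd_dblA_neq eB eNA BN; rewrite BA (ecaddC (EQ_add eB eB) eNA) => E.
by rewrite (ecaddC eA eB) -E ecaddNKl //; exact: EQ_add.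
Qed.

(** Both sides are [P + Z] for [Z = 2(P + A) - P]: by [ecadd_dblA] at [P + A]
    one has [Z = (P + A) + A], which is [2A + P] by [ecadd_dblA] at [A]. *)
Lemma dbl_add A P : EQ d A -> EQ d P ->
  ecadd (ecadd P A) (ecadd P A) = ecadd P (ecadd P (ecadd A A)).
Proof.
move=> eA eP; have eNP := EQ_neg eP.
have eB := EQ_add eP eA; have eAA := EQ_add eA eA; have eBB := EQ_add eB eB.
rewrite -[LHS](ecaddNKl eP eBB); congr ecadd.
rewrite (ecaddC eNP eBB) ecadd_dblA // (ecaddC eB eNP) ecaddKl //.
by rewrite (ecaddC eB eA) (ecaddC eP eA) -ecadd_dblA // (ecaddC eAA eP).
Qed.

Lemma EQ_mul n P : EQ d P -> EQ d (ecmul n P).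
Proof. by move=> eP; elim: n => // n IH; exact: EQ_add. Qed.

Lemma ecmul_double n P : EQ d P ->
  ecmul n.*2 P = ecadd (ecmul n P) (ecmul n P).
Proof.
move=> eP; elim: n => // n IH; rewrite doubleS /ecmul !iterS -!/(ecmul _ P).
by rewrite dbl_add ?IH //; exact: EQ_mul.
Qed.
End Group.

(** * Heights of rational numbers *)

Definition rat_height (t : rat) : int := Num.max `|numq t| `|denq t|.

Lemma numq_le_height t : `|numq t| <= rat_height t.
Proof. by rewrite le_max lexx. Qed.

Lemma denq_le_height t : `|denq t| <= rat_height t.
Proof. by rewrite le_max lexx orbT. Qed.

Lemma rat_height_ge1 t : 1 <= rat_height t.
Proof.
apply: le_trans (denq_le_height t).
by rewrite normr_denq -gtz0_ge1 denq_gt0.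
Qed.

Lemma rat_height_gt0 t : 0 < rat_height t.
Proof. exact: lt_le_trans (rat_height_ge1 t). Qed.

Lemma frac_reduce (n m : int) (q : rat := n%:~R / m%:~R) : m != 0 ->
  exists2 g : int, n = g * numq q & m = g * denq q.
Proof.
move=> m0; have m0' : m%:~R != 0 :> rat by rewrite intr_eq0.
have e : n * denq q = m * numq q.
  apply: (@intr_inj rat); rewrite !rmorphM /= [(numq q)%:~R]numqE.
  by rewrite /q mulrA (mulrC m%:~R) divfK.
have : (denq q %| m * numq q)%Z by rewrite -e dvdz_mull.
rewrite Gauss_dvdzl; last by rewrite /coprimez gcdzC; exact: coprime_num_den.
case/dvdzP => g eg; exists g => //.
by apply: (mulIf (denq_neq0 q)); rewrite e eg; ring.
Qed.

Lemma rat_height_frac_le (n m : int) : m != 0 ->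
  rat_height (n%:~R / m%:~R) <= Num.max `|n| `|m|.
Proof.
move=> m0; have [g en em] := frac_reduce n m0.
have g1 : 1 <= `|g|.
  rewrite -gtz0_ge1 normr_gt0.
  by apply: contra m0 => /eqP g0; rewrite em g0 mul0r.
have -> : `|n| = `|g| * `|numq (n%:~R / m%:~R)| by rewrite {1}en normrM.
have -> : `|m| = `|g| * `|denq (n%:~R / m%:~R)| by rewrite {1}em normrM.
rewrite -maxr_pMr ?normr_ge0 //.
by rewrite ler_peMl // ltW // rat_height_gt0.
Qed.

Lemma rat_height_exp (x : rat) n : rat_height (x ^+ n) = rat_height x ^+ n.
Proof.
have cop : coprime `|numq x ^+ n| `|denq x ^+ n|.
  by rewrite !abszX coprimeXl // coprimeXr // coprime_num_den.
have e : x ^+ n = (numq x ^+ n)%:~R / (denq x ^+ n)%:~R.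
  by rewrite -{1}(divq_num_den x) expr_div_n !rmorphXn.
rewrite /rat_height {1 2}e coprimeq_num // coprimeq_den //.
rewrite expf_eq0 denq_eq0 andbF gtr0_sg ?exprn_gt0 ?denq_gt0 // mul1r.
rewrite normr_id !normrX.
have [h|/ltW h] := leP `|numq x| `|denq x|.
  by rewrite !max_r // lerXn2r ?nnegrE.
by rewrite !max_l // lerXn2r ?nnegrE.
Qed.

Lemma rat_height_mul_int (x : rat) (d : int) : d != 0 ->
  rat_height (x * d%:~R) <= rat_height x * `|d|.
Proof.
move=> d0; have -> : x * d%:~R = (numq x * d)%:~R / (denq x)%:~R.
  by rewrite -{1}(divq_num_den x) rmorphM /= mulrAC.
apply: le_trans (rat_height_frac_le _ (denq_neq0 x)) _.
have d1 : 1 <= `|d| by rewrite -gtz0_ge1 normr_gt0.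
rewrite ge_max normrM ler_wpM2r ?numq_le_height //=.
apply: le_trans (denq_le_height x) _.
by rewrite ler_peMr // ltW // rat_height_gt0.
Qed.

Lemma rat_height_div_int (x : rat) (d : int) : d != 0 ->
  rat_height (x / d%:~R) <= rat_height x * `|d|.
Proof.
move=> d0; have -> : x / d%:~R = (numq x)%:~R / (denq x * d)%:~R.
  by rewrite -{1}(divq_num_den x) rmorphM /= invfM mulrA.
apply: le_trans (rat_height_frac_le _ _) _.
  by rewrite mulf_neq0 ?denq_eq0.
have d1 : 1 <= `|d| by rewrite -gtz0_ge1 normr_gt0.
rewrite ge_max normrM [X in _ && X]ler_wpM2r ?denq_le_height // andbT.
apply: le_trans (numq_le_height x) _.
by rewrite ler_peMr // ltW // rat_height_gt0.
Qed.

(** The lower bound for the height of a fraction [N / M] of two forms in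
    [u], [w]: a Bezout relation bounds both the cancellation (a common factor
    of [N] and [M] divides [r u^n] and [r w^n], hence [r]) and the size, and
    the two losses of a factor [r] compensate each other. *)
Lemma height_ge_of_bezout (u w N M A B A' B' r H k : int) (n : nat) :
  coprimez u w -> r != 0 -> M != 0 ->
  H = rat_height (N%:~R / M%:~R) ->
  A * N + B * M = r * u ^+ n -> A' * N + B' * M = r * w ^+ n ->
  `|A| + `|B| <= k -> `|A'| + `|B'| <= k -> (Num.max `|u| `|w|) ^+ n <= k * H.
Proof.
move=> cop r0 M0 -> eu ew ku kw.
have [g eN eM] := frac_reduce N M0.
have hs := numq_le_height (N%:~R / M%:~R).
have hq := denq_le_height (N%:~R / M%:~R).
have H0 := rat_height_gt0 (N%:~R / M%:~R).
move: (rat_height _) (numq _) (denq _) eN eM hs hq H0 => H' s q eN eM hs hq H0.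
have eu' : r * u ^+ n = g * (A * s + B * q) by rewrite -eu {1}eN {1}eM; ring.
have ew' : r * w ^+ n = g * (A' * s + B' * q) by rewrite -ew {1}eN {1}eM; ring.
have gr : `|g| <= `|r|.
  have /coprimezP[[a b] /= ab] : coprimez (u ^+ n) (w ^+ n).
    by rewrite coprimezXl // coprimezXr.
  have gd : r = g * (a * (A * s + B * q) + b * (A' * s + B' * q)).
    transitivity (a * (r * u ^+ n) + b * (r * w ^+ n)).
      by rewrite -[LHS]mulr1 -ab; ring.
    by rewrite eu' ew'; ring.
  rewrite {1}gd normrM ler_peMr // -gtz0_ge1 normr_gt0.
  by apply: contra r0 => /eqP z; rewrite gd z mulr0.
have bd X Y : `|X| + `|Y| <= k -> `|g * (X * s + Y * q)| <= `|r| * (k * H').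
  move=> kXY; rewrite normrM ler_pM //.
  apply: le_trans (ler_normD _ _) _; rewrite !normrM.
  apply: (@le_trans _ _ ((`|X| + `|Y|) * H')).
    by rewrite mulrDl lerD // ler_wpM2l.
  by rewrite ler_wpM2r // ltW.
have rp : 0 < `|r| by rewrite normr_gt0.
have [_|_] := leP `|u| `|w|; rewrite -(ler_pM2l rp) -normrX -normrM.
  by rewrite ew' bd.
by rewrite eu' bd.
Qed.

(** * Doubling on the parameter [x^3 / d] *)

Definition dbl_param (t : rat) : rat := t * (t - 8) ^+ 3 / (64 * (t + 1) ^+ 3).

Lemma dbl_param_frac t (u := numq t) (w := denq t) : t != -1 ->
  dbl_param t = (u * (u - 8 * w) ^+ 3)%:~R / (64 * w * (u + w) ^+ 3)%:~R /\
  64 * w * (u + w) ^+ 3 != 0.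
Proof.
move=> t1; have w0 : w%:~R != 0 :> rat by rewrite intr_eq0 denq_eq0.
have et : t = u%:~R / w%:~R by rewrite divq_num_den.
have uw0 : (u + w)%:~R != 0 :> rat.
  apply: contra t1 => /eqP h; rewrite -addr_eq0 et; apply/eqP.
  by apply: (mulIf w0); rewrite mul0r mulrDl divfK // mul1r -h rmorphD.
split; last first.
  have wz : w != 0 by rewrite denq_eq0.
  by rewrite !mulf_neq0 ?expf_neq0 // -(intr_eq0 rat).
rewrite /dbl_param et.
rewrite !(rmorphM, rmorphD, rmorphB, rmorphXn, rmorph1, rmorphN) /=.
rewrite rmorphD in uw0.
by field; rewrite w0 uw0.
Qed.

Lemma dbl_param_height_le : exists2 K : int, 0 < K &
  forall t, t != -1 -> rat_height (dbl_param t) <= K * rat_height t ^+ 4.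
Proof.
exists (9 ^+ 3); first by rewrite exprn_gt0.
move=> t t1; have [-> m0] := dbl_param_frac t1.
apply: le_trans (rat_height_frac_le _ m0) _.
have h0 := rat_height_gt0 t.
have hu := numq_le_height t; have hw := denq_le_height t.
move: (rat_height t) (numq t) (denq t) h0 hu hw {t1 m0} => h u w h0 hu hw.
have hn : `|u - 8 * w| <= 9 * h.
  by apply: le_trans (ler_normB _ _) _; rewrite normrM ger0_norm //; lia.
have hm : `|u + w| <= 2 * h by apply: le_trans (ler_normD _ _) _; lia.
have h0' := ltW h0.
rewrite ge_max [`|u * _|]normrM [`|_ * (u + w) ^+ 3|]normrM !normrX normrM.
apply/andP; split.
  have -> : 9 ^+ 3 * h ^+ 4 = h * (9 * h) ^+ 3 by ring.
  by rewrite ler_pM ?exprn_ge0 ?lerXn2r ?nnegrE ?mulr_ge0.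
apply: (@le_trans _ _ (64 * h * (2 * h) ^+ 3)).
  rewrite ler_pM ?mulr_ge0 ?exprn_ge0 ?lerXn2r ?nnegrE ?mulr_ge0 //.
  by rewrite ger0_norm // ler_wpM2l.
have -> : 64 * h * (2 * h) ^+ 3 = 8 ^+ 3 * h ^+ 4 by ring.
by rewrite ler_wpM2r ?exprn_ge0 // lerXn2r.
Qed.

Definition cubic_form (a : int * int * int * int) (u w : int) : int :=
  let: (a0, a1, a2, a3) := a in
  a0 * u ^+ 3 + a1 * u ^+ 2 * w + a2 * u * w ^+ 2 + a3 * w ^+ 3.

Definition coef_norm (a : int * int * int * int) : int :=
  let: (a0, a1, a2, a3) := a in `|a0| + `|a1| + `|a2| + `|a3|.

Lemma coef_norm_ge0 a : 0 <= coef_norm a.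
Proof. by case: a => [[[a0 a1] a2] a3]; rewrite !addr_ge0. Qed.

Lemma cubic_form_le a (u w h : int) : `|u| <= h -> `|w| <= h ->
  `|cubic_form a u w| <= coef_norm a * h ^+ 3.
Proof.
case: a => [[[a0 a1] a2] a3] hu hw /=.
have h0 : 0 <= h := le_trans (normr_ge0 _) hu.
rewrite !mulrDl.
apply: le_trans (ler_normD _ _) (lerD _ _).
  apply: le_trans (ler_normD _ _) (lerD _ _).
    apply: le_trans (ler_normD _ _) (lerD _ _).
      by rewrite normrM normrX ler_wpM2l // lerXn2r ?nnegrE.
    rewrite -mulrA normrM ler_wpM2l // normrM normrX (exprSr h 2).
    by rewrite ler_pM ?exprn_ge0 ?lerXn2r ?nnegrE.
  rewrite -mulrA normrM ler_wpM2l // normrM normrX (exprS h 2).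
  by rewrite ler_pM ?exprn_ge0 ?lerXn2r ?nnegrE.
by rewrite normrM normrX ler_wpM2l // lerXn2r ?nnegrE.
Qed.

(** The two quartic forms have no common zero, so their resultant (which only
    involves the primes 2 and 3) gives such cofactors; they are the solutions
    of an 8 by 8 linear system, hidden behind an existential because only
    their degree matters. *)
Lemma dbl_param_bezout :
  exists (r : int) (A B A' B' : int * int * int * int),
  r != 0 /\ forall u w,
    let N := u * (u - 8 * w) ^+ 3 in
    let M := 64 * w * (u + w) ^+ 3 in
    cubic_form A u w * N + cubic_form B u w * M = r * u ^+ 7 /\
    cubic_form A' u w * N + cubic_form B' u w * M = r * w ^+ 7.
Proof.
exists (2 ^+ 6 * 3 ^+ 9).
exists (2 ^+ 6 * 3 ^+ 9, 2 ^+ 9 * (11 * 23 * 29), 2 ^+ 13 * 457, 2 ^+ 16 * 19).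
exists (2 ^+ 12 * 101, - (2 ^+ 19 * 7), 2 ^+ 19 * 19, 0).
exists (0, 2 ^+ 7 * 19, 2 ^+ 10 * 7, 2 ^+ 6 * 101).
exists (- 38, 914, - (11 * 23 * 29), 3 ^+ 9).
split; first by rewrite mulf_neq0 ?expf_neq0.
by move=> u w /=; split; ring.
Qed.

Lemma dbl_param_height_ge : exists2 K : int, 0 < K &
  forall t, t != -1 -> rat_height t ^+ 4 <= K * rat_height (dbl_param t).
Proof.
have [r [A [B [A' [B' [r0 bezout]]]]]] := dbl_param_bezout.
exists (1 + (coef_norm A + coef_norm B) + (coef_norm A' + coef_norm B')).
  by rewrite -addrA ltr_pwDl // !addr_ge0 ?coef_norm_ge0.
move=> t t1; have [e m0] := dbl_param_frac t1.
have cop : coprimez (numq t) (denq t) by exact: coprime_num_den.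
have h0 := rat_height_gt0 t.
have hu := numq_le_height t; have hw := denq_le_height t.
have h3 : 0 <= rat_height t ^+ 3 by rewrite exprn_ge0 // ltW.
have [eu ew] := bezout (numq t) (denq t).
rewrite -(@ler_pM2r _ (rat_height t ^+ 3)) ?exprn_gt0 // -exprD mulrAC.
apply: (height_ge_of_bezout cop r0 m0 (f_equal rat_height e) eu ew).
- apply: (@le_trans _ _ ((coef_norm A + coef_norm B) * rat_height t ^+ 3)).
    by rewrite mulrDl lerD ?cubic_form_le.
  by rewrite ler_wpM2r // (addrC 1) -addrA lerDl !addr_ge0 ?coef_norm_ge0.
- apply: (@le_trans _ _ ((coef_norm A' + coef_norm B') * rat_height t ^+ 3)).
    by rewrite mulrDl lerD ?cubic_form_le.
  by rewrite ler_wpM2r // lerDr !addr_ge0 ?coef_norm_ge0.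
Qed.

(** The value 0 at the origin (whose true parameter is infinite) only serves to
    make the function total; its height 1 is the least possible, so a point of
    larger height is not the origin. *)
Definition ecparam (d : int) (P : ecpoint) : rat :=
  if P is Affine x _ then x ^+ 3 / d%:~R else 0.

Lemma ecparam_add1 (d : int) x y : d != 0 -> EQ d (Affine x y) ->
  ecparam d (Affine x y) + 1 = y ^+ 2 / d%:~R.
Proof.
move=> d0; rewrite /EQ/= => ->.
by rewrite mulrDl divff // intr_eq0.
Qed.

Lemma ecparam_neqN1 (d : int) x y : d != 0 -> EQ d (Affine x y) ->
  (ecparam d (Affine x y) != -1) = (y != 0).
Proof.
move=> d0 e; rewrite -addr_eq0 (ecparam_add1 d0 e) mulf_eq0 invr_eq0 intr_eq0.
by rewrite (negbTE d0) orbF expf_eq0.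
Qed.

Lemma ecparam_dbl (d : int) x y : d != 0 -> EQ d (Affine x y) -> y != 0 ->
  ecparam d (ecadd (Affine x y) (Affine x y)) =
  dbl_param (ecparam d (Affine x y)).
Proof.
move=> d0 e y0; rewrite ecadd_dbl // /dbl_param (ecparam_add1 d0 e) /ecparam.
have D0 : d%:~R != 0 :> rat by rewrite intr_eq0.
have ed : y ^+ 2 = x ^+ 3 + d%:~R by [].
have -> : (3 * x ^+ 2 / (2 * y)) ^+ 2 - x - x =
    x * (x ^+ 3 - 8 * d%:~R) / (4 * y ^+ 2).
  have -> : d%:~R = y ^+ 2 - x ^+ 3 by rewrite ed addrAC subrr add0r.
  by field.
by field; rewrite y0 D0.
Qed.

(** * The canonical height in terms of the parameter *)

Section CanonicalHeight.
Variable R : realType.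

Definition ln_height (t : rat) : R := ln (rat_height t)%:~R.

Lemma ln_le_int (a b : int) :
  0 < a -> a <= b -> ln (a%:~R : R) <= ln (b%:~R : R).
Proof.
move=> a0 ab; rewrite ler_ln ?posrE ?ltr0z ?ler_int //.
exact: lt_le_trans ab.
Qed.

Lemma ln_height_exp3 (x : rat) : ln_height (x ^+ 3) = 3 * ln_height x.
Proof.
rewrite /ln_height rat_height_exp rmorphXn /= lnXn ?ltr0z ?rat_height_gt0 //.
by rewrite mulr_natl.
Qed.

Lemma ln_height_dbl_param : exists2 C : R, 0 <= C &
  forall t, t != -1 -> `|ln_height (dbl_param t) - 4 * ln_height t| <= 3 * C.
Proof.
have [K K0 hK] := dbl_param_height_ge; have [L L0 hL] := dbl_param_height_le.
have ln4 t (c : int) : 0 < c ->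
    ln ((c * rat_height t ^+ 4)%:~R : R) = ln c%:~R + 4 * ln_height t.
  move=> c0; have h0 := rat_height_gt0 t.
  rewrite rmorphM /= lnM ?posrE ?ltr0z ?exprn_gt0 //.
  by rewrite rmorphXn /= lnXn ?ltr0z // mulr_natl.
have K1 : 0 <= ln (K%:~R : R).
  by rewrite ln_ge0 // -[1]/(1%:~R) ler_int -gtz0_ge1.
have L1 : 0 <= ln (L%:~R : R).
  by rewrite ln_ge0 // -[1]/(1%:~R) ler_int -gtz0_ge1.
exists (3^-1 * (ln (K%:~R : R) + ln (L%:~R : R))).
  by rewrite mulr_ge0 // addr_ge0.
move=> t t1; rewrite mulVKf //.
have h1 := ln_le_int (rat_height_gt0 _) (hL t t1).
rewrite ln4 // in h1.
have h2 : ln ((1 * rat_height t ^+ 4)%:~R : R) <=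
          ln ((K * rat_height (dbl_param t))%:~R : R).
  by rewrite ln_le_int ?mul1r ?hK // exprn_gt0 // rat_height_gt0.
rewrite ln4 // ln1 add0r rmorphM /= lnM ?posrE ?ltr0z // ?rat_height_gt0 // in h2.
rewrite -!/(ln_height _) in h1 h2.
by rewrite ler_norml; apply/andP; split; lra.
Qed.

(** Tate's telescoping argument: [a k / 4^k + C / 4^k] decreases and
    [a k / 4^k - C / 4^k] increases. *)
Lemma quadrupling_limit (a : nat -> R) (C : R) :
  (forall k, `|a k.+1 - 4 * a k| <= 3 * C) ->
  exists2 l : R, (fun k => (4 ^+ k)^-1 * a k) @ \oo --> l & `|l - a 0%N| <= C.
Proof.
move=> aC; pose p k : R := (4 ^+ k)^-1.
have p0 k : 0 < p k by rewrite invr_gt0 exprn_gt0.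
have pS k : p k = 4 * p k.+1 by rewrite /p exprS invfM mulVKf.
have C0 : 0 <= C by have := le_trans (normr_ge0 _) (aC 0%N); lra.
have step k :
    - (3 * C * p k.+1) <= p k.+1 * a k.+1 - p k * a k <= 3 * C * p k.+1.
  have := aC k; rewrite -ler_norml => h.
  have -> : p k.+1 * a k.+1 - p k * a k = p k.+1 * (a k.+1 - 4 * a k).
    by rewrite (pS k); ring.
  by rewrite normrM (gtr0_norm (p0 _)) mulrC ler_wpM2r // ltW.
pose s k := p k * a k.
have lo k : a 0%N - C <= s k - C * p k.
  elim: k => [|k IH]; first by rewrite /s /p expr0 invr1 mul1r mulr1.
  apply: le_trans IH _; rewrite /s; have /andP[h _] := step k.
  by have := pS k; nra.
have dec : {homo (fun k => s k + C * p k) : n m / (n <= m)%N >-> m <= n}.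
  apply/nonincreasing_seqP => k; rewrite /s; have /andP[_ h] := step k.
  by have := pS k; nra.
have cv0 : (fun k => C * p k) @ \oo --> (0 : R).
  rewrite -(mulr0 C); apply: cvgMr.
  rewrite (_ : p = (fun k => (4^-1) ^+ k)).
    by apply: cvg_expr; rewrite ger0_norm; lra.
  by apply/funext => k; rewrite /p exprVn.
have cvb : cvgn (fun k => s k + C * p k).
  apply: nonincreasing_is_cvgn dec _; exists (a 0%N - C) => _ [k _ <-].
  have := lo k; have := p0 k; nra.
have cvs : s @ \oo --> limn (fun k => s k + C * p k).
  have es : (fun k => s k + C * p k) \- (fun k => C * p k) = s.
    by apply/funext => k /=; rewrite addrK.
  by rewrite -[in X in X @ _]es -[X in _ --> X]subr0; exact: cvgB.
exists (limn (fun k => s k + C * p k)) => //.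
rewrite ler_distl; apply/andP; split.
  apply: limr_ge => //; apply: nearW => k; have := lo k; have := p0 k; nra.
have := nonincreasing_cvgn_ge dec cvb 0%N.
by rewrite /s /p expr0 invr1 mul1r mulr1.
Qed.

Lemma ln_height_param_dist (d : int) (x : rat) : d != 0 ->
  `|3 * ln_height x - ln_height (x ^+ 3 / d%:~R)| <= ln (`|d|%:~R : R).
Proof.
move=> d0; have d0' : 0 < `|d| by rewrite normr_gt0.
have lnM' (t : rat) :
    ln ((rat_height t * `|d|)%:~R : R) = ln_height t + ln `|d|%:~R.
  by rewrite rmorphM /= lnM ?posrE ?ltr0z ?rat_height_gt0.
rewrite -ln_height_exp3.
have h1 := ln_le_int (rat_height_gt0 _) (rat_height_div_int (x ^+ 3) d0).
have h2 := ln_le_int (rat_height_gt0 _)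
                     (rat_height_mul_int (x ^+ 3 / d%:~R) d0).
rewrite divfK ?intr_eq0 // in h2.
rewrite !lnM' -!/(ln_height _) in h1 h2.
by rewrite ler_norml; apply/andP; split; lra.
Qed.

(** The constant is independent of [d]: the discrepancy [log |d|] between
    [3 h(x)] and [h(t)] is divided by [4^k] in the limit. *)
Lemma canonical_height_ecparam : exists2 C : R, 0 <= C &
  forall d P, d != 0 -> EQ d P -> (forall k, ecmul (2 ^ k) P <> Origin) ->
    `|canonical_height R P - 6^-1 * ln_height (ecparam d P)| <= C.
Proof.
have [C C0 hC] := ln_height_dbl_param; exists C => // d P d0 eP nO.
have mulS k : ecmul (2 ^ k.+1) P = ecadd (ecmul (2 ^ k) P) (ecmul (2 ^ k) P).
  by rewrite expnS mul2n (ecmul_double d0).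
pose a k := ln_height (ecparam d (ecmul (2 ^ k) P)).
have aC k : `|a k.+1 - 4 * a k| <= 3 * C.
  rewrite /a mulS; have := EQ_mul (2 ^ k) eP; have := nO k; have := nO k.+1.
  rewrite mulS; case: (ecmul _ _) => // x y n1 n2 e.
  have y0 : y != 0.
    by apply/eqP => y0; apply: n1; rewrite /= y0 oppr0 !eqxx.
  by rewrite (ecparam_dbl d0 e y0) hC // (ecparam_neqN1 d0 e).
have [l al la] := quadrupling_limit aC.
pose b k : R := log_height R (xcoord (ecmul (2 ^ k) P)).
have bl : (fun k => (4 ^+ k)^-1 * b k) @ \oo --> 3^-1 * l.
  pose c := 3^-1 * ln (`|d|%:~R : R).
  have bc k : `|b k - 3^-1 * a k| <= c.
    rewrite /b /a; have := EQ_mul (2 ^ k) eP; have := nO k.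
    case: (ecmul _ _) => // x y _ e.
    have := ln_height_param_dist x d0.
    rewrite -[log_height R _]/(ln_height x) -/(ecparam _ _).
    rewrite /c !ler_norml => /andP[h1 h2].
    by apply/andP; split; rewrite /ecparam; lra.
  have p0 k : 0 < (4 ^+ k)^-1 :> R by rewrite invr_gt0 exprn_gt0.
  have cv0 : (fun k => (4 ^+ k)^-1 * c) @ \oo --> (0 : R).
    rewrite -(mul0r c); apply: cvgMl.
    rewrite (_ : (fun x => _) = (fun k => (4^-1) ^+ k)).
      by apply: cvg_expr; rewrite ger0_norm; lra.
    by apply/funext => k; rewrite exprVn.
  have al3 : (fun k => 3^-1 * ((4 ^+ k)^-1 * a k)) @ \oo --> 3^-1 * l.
    exact: cvgMr.
  apply: (@squeeze_cvgr _ _ _ _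
     (fun k => 3^-1 * ((4 ^+ k)^-1 * a k) - (4 ^+ k)^-1 * c)
     (fun k => 3^-1 * ((4 ^+ k)^-1 * a k) + (4 ^+ k)^-1 * c)).
  - apply: nearW => k; have := bc k; rewrite ler_distl => /andP[h1 h2].
    have := p0 k; move: (_ ^-1) h1 h2 => p h1 h2 p0k.
    by apply/andP; split; nra.
  - by rewrite -[X in _ --> X]subr0; exact: cvgB.
  - by rewrite -[X in _ --> X]addr0; exact: cvgD.
rewrite /canonical_height (cvg_lim _ bl) //.
move: la; rewrite /a /ecmul /= ecadd0r !ler_norml => /andP[h1 h2].
by apply/andP; split; lra.
Qed.
End CanonicalHeight.

(** * The lower bound *)

Lemma sixth_power_free_dvd (d : int) (n : nat) :
  sixth_power_free d -> (n%:Z ^+ 6 %| d)%Z -> n = 1%N.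
Proof.
move=> [d0 dp] nd; apply/eqP; apply: contraT => n1.
have [p pp pn] : exists2 p, prime p & (p %| n)%N.
  exists (pdiv n); rewrite ?pdiv_dvd // pdiv_prime // ltnNge.
  by case: n n1 nd => [|[]] // _; rewrite expr0n /= dvd0z (negbTE d0).
by have /negP[] := dp _ pp; apply: dvdz_trans nd; apply: dvdz_exp2r.
Qed.

(** The sixth power of the denominator of [r] divides [d], so [r] is an
    integer. *)
Lemma sixth_power_free_le (d n : int) (r : rat) :
  sixth_power_free d -> n != 0 -> d%:~R * r ^+ 6 = n%:~R -> `|d| <= `|n|.
Proof.
move=> df n0 e.
have r0 : denq r != 0 by rewrite denq_eq0.
have E : d * numq r ^+ 6 = n * denq r ^+ 6.
  apply: (@intr_inj rat); rewrite [LHS]rmorphM [RHS]rmorphM !rmorphXn /= -e.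
  by rewrite [(numq r)%:~R]numqE; ring.
have dd : (denq r ^+ 6 %| d)%Z.
  rewrite -(@Gauss_dvdzl _ _ (numq r ^+ 6)); first by rewrite E; exact: dvdz_mull.
  rewrite coprimezXl // coprimezXr // /coprimez gcdzC.
  exact: coprime_num_den.
have d1 : `|denq r|%N = 1%N.
  by apply: (sixth_power_free_dvd df); rewrite absz_denq.
have en : n = d * numq r ^+ 6 by rewrite E -absz_denq d1 expr1n mulr1.
rewrite en normrM ler_peMr // -gtz0_ge1 normr_gt0.
by apply: contra n0 => /eqP z; rewrite en z mulr0.
Qed.

(** With [t = u / w] and [v = u + w], the integer [w u^2 v^3] is
    [d (w x y / d)^6], because [x^3 = d u / w] and [y^2 = d v / w]. *)
Lemma sixth_power_free_le_height (d : int) x y : sixth_power_free d ->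
  EQ d (Affine x y) -> x != 0 -> y != 0 ->
  `|d| <= 8 * rat_height (ecparam d (Affine x y)) ^+ 6.
Proof.
move=> df e x0 y0; have d0 := df.1.
have e1 := ecparam_add1 d0 e; move: e1; set t := ecparam _ _ => e1.
have h0 := ltW (rat_height_gt0 t).
have hu := numq_le_height t; have hw := denq_le_height t.
have D0 : d%:~R != 0 :> rat by rewrite intr_eq0.
have W0 : (denq t)%:~R != 0 :> rat by rewrite intr_eq0 denq_eq0.
have eu : (numq t)%:~R = x ^+ 3 / d%:~R * (denq t)%:~R :> rat by rewrite numqE.
have ev : (numq t + denq t)%:~R = y ^+ 2 / d%:~R * (denq t)%:~R :> rat.
  by rewrite rmorphD /= numqE -e1 mulrDl mul1r.
move: (rat_height t) (numq t) (denq t) h0 hu hw W0 eu ev.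
move=> h u w h0 hu hw W0 eu ev.
have hv : `|u + w| <= 2 * h by apply: le_trans (ler_normD _ _) _; lia.
have le_n : `|w * u ^+ 2 * (u + w) ^+ 3| <= 8 * h ^+ 6.
  have -> : 8 * h ^+ 6 = h * h ^+ 2 * (2 * h) ^+ 3 by ring.
  rewrite 2!normrM !normrX.
  rewrite ler_pM ?mulr_ge0 ?exprn_ge0 ?lerXn2r ?nnegrE ?mulr_ge0 //.
  by rewrite ler_pM ?exprn_ge0 ?lerXn2r ?nnegrE.
have en : (w * u ^+ 2 * (u + w) ^+ 3)%:~R =
    w%:~R * u%:~R ^+ 2 * (u + w)%:~R ^+ 3 :> rat.
  by rewrite [LHS]rmorphM [X in X * _]rmorphM !rmorphXn.
apply: le_trans le_n.
apply: (@sixth_power_free_le _ _ (w%:~R * x * y / d%:~R)) => //.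
  rewrite -(intr_eq0 rat) en eu ev.
  by rewrite !(mulf_neq0, expf_neq0, invr_eq0).
by rewrite en eu ev; field.
Qed.

Lemma non_torsion_mul (d : int) P n : (EQ d `\` EQ_tors d) P -> (0 < n)%N ->
  ecmul n P <> Origin.
Proof. by move=> [eP nt] n0 h; apply: nt; split=> //; exists n. Qed.

Lemma non_torsion_affine (d : int) P : (EQ d `\` EQ_tors d) P ->
  exists x y, [/\ P = Affine x y, x != 0 & y != 0].
Proof.
move=> hP; have n1 := non_torsion_mul hP (isT : (0 < 1)%N).
have n2 := non_torsion_mul hP (isT : (0 < 2)%N).
have n3 := non_torsion_mul hP (isT : (0 < 3)%N).
case: P {hP} n1 n2 n3 => // x y _ n2 n3; exists x, y.
have y0 : y != 0.
  by apply/eqP => y0; apply: n2; rewrite /ecmul /= y0 oppr0 !eqxx.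
split=> //; apply/eqP => x0; apply: n3.
have dblE : ecadd (Affine 0 y) (Affine 0 y) = Affine 0 (- y).
  rewrite ecadd_dbl //.
  have -> : 3 * 0 ^+ 2 / (2 * y) = 0 by rewrite expr0n /= mulr0 mul0r.
  by rewrite expr0n /= !subr0 mul0r sub0r.
rewrite x0 /ecmul !iterS [ecadd _ (iter 0 _ _)]ecadd0r dblE.
exact: (ecadd_oppr (Affine 0 y)).
Qed.

Lemma log_zeta_lower (R : realType) : exists C : R, forall d : int,
  sixth_power_free d -> ((36^-1 * ln `|d|%:~R - C)%:E <= log_zeta R d)%E.
Proof.
have [C C0 hC] := canonical_height_ecparam R.
exists (36^-1 * ln 8 + C) => d df; apply/ereal_infP => _ [P hP <-].
have [eP _] := hP; rewrite lee_fin.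
have nO k : ecmul (2 ^ k) P <> Origin.
  by apply: (non_torsion_mul hP); rewrite expn_gt0.
have := hC d P df.1 eP nO; have [x [y [E x0 y0]]] := non_torsion_affine hP.
have d1 : 0 < `|d| by rewrite normr_gt0 df.1.
rewrite E in eP *.
have := ln_le_int R d1 (sixth_power_free_le_height df eP x0 y0).
have h0 := rat_height_gt0 (ecparam d (Affine x y)).
rewrite rmorphM /= lnM ?posrE ?ltr0z ?exprn_gt0 // rmorphXn /= lnXn ?ltr0z //.
rewrite -/(ln_height R _) -mulr_natl ler_distl => h1 /andP[h2 _].
have -> : ln 8 = ln 8%:~R :> R by [].
lra.
Qed.

(** * A sieve for squarefree values of three linear forms *)

(** Each block of [s] consecutive values of [j] contains at most one solution,
    so [j %/ s] is injective on the solutions. *)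
Lemma count_dvdn_arith (s a b J : nat) : (0 < s)%N -> coprime s a ->
  (\sum_(j < J) (s %| a * j + b) <= (J %/ s).+1)%N.
Proof.
move=> s0 sa; rewrite -big_mkcond sum1_card.
pose f (j : 'I_J) : 'I_(J %/ s).+1 := inord (j %/ s).
rewrite -(card_ord (J %/ s).+1) -(@card_in_imset _ _ f) ?max_card //.
have fE j : f j = (j %/ s)%N :> nat.
  by rewrite /f inordK // ltnS leq_div2r // ltnW.
have inj_le (i j : 'I_J) : (i <= j)%N -> (s %| a * i + b)%N ->
    (s %| a * j + b)%N -> f i = f j -> i = j.
  move=> ij di dj /(congr1 val) /=; rewrite !fE => q; apply: val_inj => /=.
  have : (s %| j - i)%N.
    rewrite -(@Gauss_dvdr s a) // mulnBr.
    by rewrite -(subnDr b) dvdn_sub.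
  have h1 := divn_eq i s; have h2 := divn_eq j s.
  have h3 := ltn_pmod j s0; have h4 := ltn_pmod i s0.
  move/dvdnP => [k hk].
  case: k hk => [|k] hk; [lia|].
  have : (s <= j - i)%N by rewrite hk mulSn leq_addr.
  rewrite q in h1; lia.
move=> i j; rewrite !unfold_in => di dj e.
by have [ij|/ltnW ij] := leqP i j; [|apply/esym]; apply: inj_le.
Qed.

(** Telescoping, from [1 / (2i + 3)^2 < 1 / (4 (i + 1) (i + 2))]. *)
Lemma sum_divn_odd_squares (J n : nat) :
  (4 * \sum_(i < n) (J %/ (2 * i + 3) ^ 2) <= J)%N.
Proof.
suff : (4 * n.+1 * \sum_(i < n) (J %/ (2 * i + 3) ^ 2) <= J * n)%N.
  by move: (\sum_(i < n) _)%N => S; nia.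
elim: n => [|n IH]; first by rewrite big_ord0 muln0.
rewrite big_ord_recr /=; move: (\sum_(i < n) _)%N IH => S IH.
have := leq_divM J ((2 * n + 3) ^ 2); move: (J %/ _)%N => x hx.
rewrite -(@leq_pmul2r n.+1) //; nia.
Qed.

(** Among the [j < J] at most [3 (J / q^2 + 1)] are spoiled by a given [q], and
    only the [q] with [q^2 < 8 J] occur; together they spoil at most
    [3 J / 4 + O(sqrt J)] values of [j]. *)
Lemma odd_squarefree_values (M : nat) : exists2 j, (M <= j)%N &
  forall q, odd q -> (2 < q)%N ->
    [/\ ~~ (q ^ 2 %| 4 * j + 1)%N, ~~ (q ^ 2 %| 4 * j + 2)%N &
        ~~ (q ^ 2 %| 8 * j + 3)%N].
Proof.
(* 8 J = (4 r)^2, so that q = 2 i + 3 ranges over i < 2 r; the size of r makes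
   3 J / 4 + 6 r < J - M *)
pose r := (13 + 2 * M)%N; pose J := (2 * r ^ 2)%N.
pose F j i : nat :=
  (((2 * i + 3) ^ 2 %| 4 * j + 1) + ((2 * i + 3) ^ 2 %| 4 * j + 2) +
   ((2 * i + 3) ^ 2 %| 8 * j + 3))%N.
have [/existsP[j /andP[Mj good]]|none] := boolP
    [exists j : 'I_J, (M <= j)%N && [forall i : 'I_(2 * r), F j i == 0%N]].
  exists (nat_of_ord j) => // q oq q2.
  have [small|big] := ltnP (q ^ 2) (8 * J).
    have qE : q = (2 * ((q - 3) %/ 2) + 3)%N.
      by have := odd_double_half q; rewrite oq divn2; lia.
    have lt_i : ((q - 3) %/ 2 < 2 * r)%N by rewrite /J in small; nia.
    move/forallP/(_ (Ordinal lt_i)) : good; rewrite /F /= -qE !addn_eq0 !eqb0.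
    by move=> /andP[/andP[]].
  have no b : (0 < b < q ^ 2)%N -> ~~ (q ^ 2 %| b)%N.
    by move=> /andP[b0 bq]; rewrite gtnNdvd.
  have jJ := ltn_ord j.
  move: (q ^ 2)%N big no => Q big no; clearbody J.
  by split; apply: no; lia.
have lo : (J - M <= \sum_(j < J) \sum_(i < 2 * r) F j i)%N.
  have -> : (J - M = \sum_(j < J) (M <= j))%N.
    rewrite -big_mkcond -(big_mkord (fun j => M <= j)%N (fun _ => 1%N)).
    have MJ : (M <= J)%N by rewrite /J /r; nia.
    rewrite (big_cat_nat (n := M)) //= big_nat_cond big1 ?add0n; last first.
      by move=> i /andP[/andP[_ h1] h2]; lia.
    rewrite big_nat_cond (eq_bigl (fun i => M <= i < J)%N); last first.
      by move=> i; lia.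
    by rewrite -big_nat sum_nat_const_nat muln1.
  apply: leq_sum => j _; case Mj : (M <= j)%N => //.
  move/existsPn/(_ j) : none; rewrite Mj /= => /forallPn [i Fi].
  by rewrite (bigD1 i) //= -lt0n in Fi *; rewrite ltn_addr // lt0n.
have hi : (\sum_(j < J) \sum_(i < 2 * r) F j i <=
    3 * \sum_(i < 2 * r) (J %/ (2 * i + 3) ^ 2) + 3 * (2 * r))%N.
  rewrite exchange_big /= -[in X in (_ <= _ + X)%N](card_ord (2 * r)).
  rewrite -sum1_card -mulnDr -big_split big_distrr /=.
  apply: leq_sum => i _; rewrite /F !big_split /=.
  have s0 : (0 < (2 * i + 3) ^ 2)%N by rewrite expn_gt0 addn_gt0 orbT.
  have c2 : coprime ((2 * i + 3) ^ 2) 2.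
    by rewrite coprimeXl // coprimen2; lia.
  have c4 : coprime ((2 * i + 3) ^ 2) 4 by rewrite (coprimeXr 2 c2).
  have c8 : coprime ((2 * i + 3) ^ 2) 8 by rewrite (coprimeXr 3 c2).
  have h1 := count_dvdn_arith 1 J s0 c4.
  have h2 := count_dvdn_arith 2 J s0 c4.
  have h3 := count_dvdn_arith 3 J s0 c8.
  apply: leq_trans (leq_add (leq_add h1 h2) h3) _; rewrite addn1; lia.
have := sum_divn_odd_squares J (2 * r); move: (leq_trans lo hi).
move: (\sum_(i < _) _)%N => S; rewrite /J /r; nia.
Qed.

(** * Points of small height *)

Lemma logn_le1 p a : prime p -> (0 < a)%N -> ~~ (p ^ 2 %| a)%N ->
  (logn p a <= 1)%N.
Proof. by move=> pp a0; rewrite pfactor_dvdn // -ltnNge. Qed.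

Section SharpFamily.
Variable j : nat.
Let u := (4 * j + 1)%N.
Let w := (4 * j + 2)%N.
Let v := (8 * j + 3)%N.

Definition sharp_disc : nat := (w * u ^ 2 * v ^ 3)%N.

Definition sharp_point : ecpoint := Affine (u * v)%:R (u * v ^ 2)%:R.

(** [u] and [w] are consecutive, so a prime divides at most one of them and
    its exponent in [w u^2 v^3] is at most 2 + 3. At the prime 2 the values are
    squarefree as well: [u], [v] are odd and 4 does not divide [w]. *)
Lemma sharp_disc_sixth_power_free :
  (forall q, odd q -> (2 < q)%N ->
     [/\ ~~ (q ^ 2 %| u)%N, ~~ (q ^ 2 %| w)%N & ~~ (q ^ 2 %| v)%N]) ->
  sixth_power_free sharp_disc%:Z.
Proof.
move=> good.
have u0 : (0 < u)%N by rewrite /u addn1.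
have w0 : (0 < w)%N by rewrite /w addn2.
have v0 : (0 < v)%N by rewrite /v addn3.
have d0 : (0 < sharp_disc)%N.
  by rewrite /sharp_disc 2!muln_gt0 !expn_gt0 u0 w0 v0.
split=> [|p pp]; first by rewrite -lt0n.
have sq : [/\ (logn p u <= 1)%N, (logn p w <= 1)%N & (logn p v <= 1)%N].
  suff [h1 h2 h3] :
      [/\ ~~ (p ^ 2 %| u)%N, ~~ (p ^ 2 %| w)%N & ~~ (p ^ 2 %| v)%N].
    by split; apply: logn_le1.
  have [->|p2] := eqVneq p 2%N.
    by rewrite (_ : 2 ^ 2 = 4)%N // /u /w /v; split; lia.
  have gp : (2 < p)%N by rewrite ltn_neqAle eq_sym p2 prime_gt1.
  by apply: good => //; case: (even_prime pp) => // /eqP; rewrite (negbTE p2).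
have uw : ~~ ((0 < logn p u) && (0 < logn p w))%N.
  rewrite -!pfactor_dvdn // expn1; apply/negP => /andP[pu pw].
  have : (p %| w - u)%N by rewrite dvdn_sub.
  rewrite (_ : w - u = 1)%N ?dvdn1; last by rewrite /w /u; lia.
  by move/eqP => p1; rewrite p1 in pp.
rewrite dvdzE abszX /= pfactor_dvdn // -ltnNge /sharp_disc.
have u2 : (0 < u ^ 2)%N by rewrite expn_gt0 u0.
have v3 : (0 < v ^ 3)%N by rewrite expn_gt0 v0.
have wu : (0 < w * u ^ 2)%N by rewrite muln_gt0 w0.
rewrite (lognM p wu v3) (lognM p w0 u2) !lognX.
by move: sq uw => [] + + +; lia.
Qed.

Lemma sharp_point_EQ : EQ sharp_disc sharp_point.
Proof.
rewrite /EQ /= /sharp_disc -!pmulrn -!natrX -natrD; congr (_%:R).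
have -> : v = (u + w)%N by rewrite /v /u /w; lia.
ring.
Qed.

Lemma sharp_param : ecparam sharp_disc sharp_point = u%:Z%:~R / w%:Z%:~R.
Proof.
rewrite /ecparam /sharp_point /sharp_disc -!pmulrn.
have u0 : u%:R != 0 :> rat by rewrite pnatr_eq0 /u addn1.
have w0 : w%:R != 0 :> rat by rewrite pnatr_eq0 /w addn2.
have v0 : v%:R != 0 :> rat by rewrite pnatr_eq0 /v addn3.
by rewrite !natrM; field; rewrite u0 w0 v0.
Qed.

Lemma sharp_height_le : rat_height (ecparam sharp_disc sharp_point) <= w%:Z.
Proof.
rewrite sharp_param; apply: le_trans (rat_height_frac_le _ _) _.
  by rewrite /w addn2.
by rewrite ge_max /w /u; apply/andP; split; lia.
Qed.

Lemma sharp_height_ge : u%:Z <= rat_height (ecparam sharp_disc sharp_point).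
Proof.
rewrite sharp_param; apply: le_trans (numq_le_height _).
rewrite coprimeq_num /=; last by rewrite /u /w addn1 addn2 coprimenS.
by rewrite gtr0_sg ?mul1r // /w addn2.
Qed.

Lemma sharp_disc_ge : (w ^ 6 <= 32 * sharp_disc)%N.
Proof.
have -> : (w ^ 6 = w * w ^ 5)%N by ring.
have wu : (w <= 2 * u)%N by rewrite /w /u; lia.
have uv : (u <= v)%N by rewrite /u /v; lia.
apply: (@leq_trans (w * (2 * u) ^ 5)).
  by rewrite leq_mul2l leq_exp2r ?wu ?orbT.
have -> : (w * (2 * u) ^ 5 = 32 * (w * u ^ 2 * u ^ 3))%N by ring.
by rewrite leq_mul2l /= /sharp_disc leq_mul2l leq_exp2r ?uv ?orbT.
Qed.

Lemma sharp_disc_gt : (j < sharp_disc)%N.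
Proof.
apply: (@leq_trans w); first by rewrite /w; lia.
by rewrite /sharp_disc -mulnA leq_pmulr // muln_gt0 !expn_gt0 /u /v addn1 addn3.
Qed.
End SharpFamily.

Lemma ecmul_modn n P m : ecmul n P = Origin -> ecmul m P = ecmul (m %% n) P.
Proof.
move=> nO; rewrite {1}(divn_eq m n) addnC; elim: (m %/ n)%N => [|c IH].
  by rewrite mul0n addn0.
by rewrite mulSn addnCA addnC {1}/ecmul iterD -/(ecmul n P) nO.
Qed.

(** Once [H^4 / K > H], doubling increases the height. In particular the
    doublings never reach the 2-torsion ([t = -1]) or the origin ([t] set to
    0), whose parameters have height 1. *)
Lemma height_growth : exists K : int,
  forall d P, d != 0 -> EQ d P -> K <= rat_height (ecparam d P) ->
  forall k, rat_height (ecparam d P) + k%:Z <=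
            rat_height (ecparam d (ecmul (2 ^ k) P)).
Proof.
have [K K0 hK] := dbl_param_height_ge.
exists (K + 2) => d P d0 eP hP; elim=> [|k IH].
  by rewrite expn0 /ecmul /= ecadd0r addr0.
rewrite expnS mul2n (ecmul_double d0) //.
have hQ : K + 2 <= rat_height (ecparam d (ecmul (2 ^ k) P)) by lia.
suff : rat_height (ecparam d (ecmul (2 ^ k) P)) + 1 <=
   rat_height (ecparam d (ecadd (ecmul (2 ^ k) P) (ecmul (2 ^ k) P))) by lia.
move: hQ (EQ_mul (2 ^ k) eP); case: (ecmul _ P) => [|x y].
  by rewrite [ecparam d Origin]/= (_ : rat_height 0 = 1) //; lia.
move=> hQ e; have t1 : ecparam d (Affine x y) != -1.
  by apply/eqP => t1; move: hQ; rewrite t1 (_ : rat_height (-1) = 1) //; lia.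
have y0 : y != 0 by rewrite -(ecparam_neqN1 d0 e).
rewrite (ecparam_dbl d0 e y0); have := hK _ t1.
move: (rat_height (dbl_param _)) (rat_height (ecparam _ _)) hQ => h' h hQ hh.
rewrite -(ler_pM2l K0); apply: le_trans hh.
have h2 : 2 <= h by lia.
have hK' : K <= h by lia.
apply: (@le_trans _ _ (h * (h + 1))); first by rewrite ler_wpM2r //; lia.
by rewrite exprS ler_wpM2l ?exprS //; nia.
Qed.

(** A torsion point has finitely many multiples, hence multiples of bounded
    height. *)
Lemma non_torsion_of_growth (d : int) P : EQ d P ->
  (forall k, rat_height (ecparam d P) + k%:Z <=
             rat_height (ecparam d (ecmul (2 ^ k) P))) ->
  (EQ d `\` EQ_tors d) P.
Proof.
move=> eP grow; split=> // -[_ [n n0 nO]].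
pose f i : int := rat_height (ecparam d (ecmul i P)).
have f0 i : 0 <= f i by rewrite ltW // rat_height_gt0.
pose B : int := \sum_(i < n) f i.
have bound i : f i <= B.
  rewrite /f (ecmul_modn i nO) -/(f _).
  rewrite /B (bigD1 (Ordinal (ltn_pmod i n0))) //= lerDl.
  by apply: sumr_ge0 => i' _; exact: f0.
have B0 : 0 <= B by apply: sumr_ge0 => i _; exact: f0.
have := grow `|B|%N; have := bound (2 ^ `|B|)%N.
have := rat_height_gt0 (ecparam d P).
by rewrite gez0_abs // -/(f _); lia.
Qed.

Lemma log_zeta_upper (R : realType) :
  exists C : R, forall M : nat, exists d : int,
  [/\ M%:Z <= `|d|, sixth_power_free d &
      (log_zeta R d <= (36^-1 * ln `|d|%:~R + C)%:E)%E].
Proof.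
have [C C0 hC] := canonical_height_ecparam R; have [K hK] := height_growth.
exists (36^-1 * ln (32%:~R) + C) => M.
(* j >= |K| makes the height large enough for height_growth *)
have [j jM good] := odd_squarefree_values (maxn M `|K|%N).
have df := sharp_disc_sixth_power_free good; have eP := sharp_point_EQ j.
set d := (sharp_disc j)%:Z in df eP *; set P := sharp_point j in eP *.
have dj := sharp_disc_gt j; rewrite geq_max in jM; have /andP[jM1 jM2] := jM.
exists d; split=> //; first by rewrite /d; lia.
have hge : K <= rat_height (ecparam d P).
  by apply: le_trans (sharp_height_ge j); lia.
have hP := non_torsion_of_growth eP (hK d P df.1 eP hge).
have nO k : ecmul (2 ^ k) P <> Origin.
  by apply: (non_torsion_mul hP); rewrite expn_gt0.
apply: ge_ereal_inf; exists (canonical_height R P)%:E; first by exists P.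
rewrite lee_fin.
have := hC d P df.1 eP nO; rewrite ler_distl => /andP[_ h1].
have w0 : 0 < (4 * j + 2)%N%:Z by rewrite addn2.
have h2 := ln_le_int R (rat_height_gt0 _) (sharp_height_le j).
have w6 : (4 * j + 2)%N%:Z ^+ 6 <= 32 * `|d|.
  have := sharp_disc_ge j.
  by rewrite -(ler_nat int) natrX [X in _ <= X]natrM !natz.
have h3 := ln_le_int R (exprn_gt0 6 w0) w6.
have d1 : 0 < `|d| by rewrite normr_gt0 df.1.
move: h3; rewrite [X in _ <= ln X]rmorphM lnM ?posrE ?ltr0z //.
rewrite rmorphXn /= lnXn ?ltr0z // -mulr_natl.
rewrite -/(ln_height R _) in h2; lra.
Qed.

(** * From logarithms to zeta *)

Lemma expR_affine_ln (R : realType) (d : int) (a b : R) : d != 0 ->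
  expR (a * ln `|d|%:~R + b) = expR b * `|d|%:~R `^ a.
Proof.
move=> d0; rewrite expRD mulrC /powR.
by rewrite intr_eq0 normr_eq0 (negbTE d0).
Qed.

Theorem proposition2p5 (R : realType) :
  (exists2 c : R, 0 < c &
     forall d : int, sixth_power_free d ->
       ((c * `|d|%:~R `^ (36^-1))%:E <= zeta R d)%E) /\
  (exists2 C : R, 0 < C &
     infinite_set [set d : int | sixth_power_free d /\
       (zeta R d <= (C * `|d|%:~R `^ (36^-1))%:E)%E]).
Proof.
split.
  have [C hC] := log_zeta_lower R; exists (expR (- C)); first exact: expR_gt0.
  move=> d df; rewrite -expR_affine_ln ?df.1 //.
  by have := hC d df; rewrite -lee_expeR.
have [C hC] := log_zeta_upper R; exists (expR C); first exact: expR_gt0.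
case/finite_seqP => s sE.
(* a member of the set that exceeds every entry of its supposed enumeration *)
have [d [dM df dz]] := hC (\sum_(e <- s) `|e|.+1)%N.
have : [set d : int | sixth_power_free d /\
       (zeta R d <= (expR C * `|d|%:~R `^ (36^-1))%:E)%E] d.
  split=> //; rewrite -expR_affine_ln ?df.1 //.
  by move: dz; rewrite -lee_expeR.
rewrite sE /= => ds; move: dM; rewrite (big_rem d) //=; lia.
Qed.
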